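(* Consider the stochastic system $$dx=f(x)\,dt+g_1(x)\,dw+g_2(x)u\,dt,\qquad E\{dw\,dw^T\}=\Sigma\Sigma^T\,dt,\qquad x\in\mathbb R^n,\ u\in\mathbb R^{m_2},$$ with nominal control $u_0$. Let $h$ be an NSSf-CBF candidate, let $\gamma_1,\gamma_2$ be class $\mathcal K_\infty$ functions whose derivatives are also class $\mathcal K_\infty$ functions, let $R_2(x,u_0)=R_2(x,u_0)^T>0$ be matrix-valued, and consider the control law $$u=u_0+\bar u(x,u_0),\qquad \bar u(x,u_0)=R_2^{-1}(L_{g_2}h)^T\,\frac{\ell\gamma_2\big(|L_{g_2}hR_2^{-1/2}|\big)}{|L_{g_2}hR_2^{-1/2}|^2}.$$ Suppose this control law makes the auxiliary system $dx=f(x)\,dt+g_1(x)\,d\bar w+g_2(x)u\,dt$ satisfy the SBFc with respect to $h$, where $\bar w$ is an independent $r$-dimensional stochastic process with incremental covariance $$\bar\Sigma\bar\Sigma^T=-2\,g_1^T\frac{\partial^2h}{\partial x^2}g_1\ \frac{\ell\gamma_1\Big(\big|g_1^T\frac{\partial^2h}{\partial x^2}g_1\big|_{\mathcal F}\Big)}{\big|g_1^T\frac{\partial^2h}{\partial x^2}g_1\big|_{\mathcal F}^2},$$ namely, suppose that for some $\alpha\in\mathcal K_h$ $$L_{f+g_2u_0}h-\ell\gamma_1\Big(\Big|g_1^T\frac{\partial^2h}{\partial x^2}g_1\Big|_{\mathcal F}\Big)+\ell\gamma_2\big(|L_{g_2}hR_2^{-1/2}|\big)\ \ge\ -\alpha(h).$$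 Then, for every $\beta\ge2$, the control law $$u=u_0+\bar u^*(x,u_0),\qquad \bar u^*=\frac\beta2R_2^{-1}(L_{g_2}h)^T\,\frac{(\gamma_2')^{-1}\big(|L_{g_2}hR_2^{-1/2}|\big)}{|L_{g_2}hR_2^{-1/2}|}$$ maximizes (over admissible $u-u_0$) the cost functional $$J(u-u_0)=\inf_{\Sigma\in\mathcal D}\Big\{\lim_{t\to\infty}E\Big[2\beta h(x(t))+\int_0^t\Big(l(x,u_0)-\beta^2\gamma_2\Big(\frac2\beta\big|R_2^{1/2}(u-u_0)\big|\Big)+\beta\lambda\gamma_1\Big(\frac{|\Sigma\Sigma^T|_{\mathcal F}}{\lambda}\Big)\Big)d\tau\Big]\Big\},$$ where $\lambda\in(0,2]$ and $$\begin{aligned}l(x,u_0)=&-2\beta\Big[L_{f+g_2u_0}h-\ell\gamma_1\Big(\Big|g_1^T\frac{\partial^2h}{\partial x^2}g_1\Big|_{\mathcal F}\Big)+\ell\gamma_2\big(|L_{g_2}hR_2^{-1/2}|\big)\Big]\\&-\beta(\beta-2)\,\ell\gamma_2\big(|L_{g_2}hR_2^{-1/2}|\big)-\beta(2-\lambda)\,\ell\gamma_1\Big(\Big|g_1^T\frac{\partial^2h}{\partial x^2}g_1\Big|_{\mathcal F}\Big)\ \le\ 2\beta\alpha(h).\end{aligned}$$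
   Context: $f,g_1,g_2$ are locally Lipschitz. An NSSf-CBF candidate is a twice differentiable barrier function candidate, i.e. $h:\mathbb R^n\to\mathbb R$ with $\inf h<0<\sup h$. $\mathcal K_h$: continuous strictly increasing functions $(\inf h,\sup h)\to\mathbb R$ vanishing at $0$; $\alpha(h(x))$ is understood to be defined for all $x$. Class $\mathcal K_\infty$: continuous strictly increasing unbounded functions on $[0,\infty)$ vanishing at $0$. $L_fh=\frac{\partial h}{\partial x}f$, $L_{g_2}h=\frac{\partial h}{\partial x}g_2$ (row vector); $|\cdot|$ is the Euclidean norm and $|X|_{\mathcal F}=({\rm Tr}\{X^TX\})^{1/2}$ the Frobenius norm. $\ell\gamma(r)=\int_0^r(\gamma')^{-1}(s)ds$ is the Legendre–Fenchel transform. Ratios of the displayed form are read so that $\bar u,\bar u^*$ are $0$ where $L_{g_2}h=0$ and $\bar\Sigma\bar\Sigma^T=0$ where $g_1^T\frac{\partial^2h}{\partial x^2}g_1=0$. That $\bar\Sigma\bar\Sigma^T$ is an incremental covariance presupposes that the displayed right-hand side is a nonnegative definite matrix. For a system with incremental noise covariance $\Sigma\Sigma^T$ the infinitesimal generator is $\mathcal Lh=L_{f+g_2u}h+\frac12{\rm Tr}\{\Sigma^Tg_1^T\frac{\partial^2h}{\partial x^2}g_1\Sigma\}$; the system satisfies the stochastic barrier function condition (SBFc) if for some $\alpha\in\mathcal K_h$, $\mathcal Lh\ge-\alpha(h)$ for all $x$. $\mathcal D$ is the set of locally bounded functions $\Sigma$ (of $x$ and possibly $t$) with values in the nonnegative definite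 $r\times r$ matrices. Admissible controls $u-u_0$ are feedbacks such that, for the covariances considered, solutions exist on $[0,\infty)$, the expectations and the limit exist (in the extended reals), and Dynkin's formula $E\{h(x(0))-h(x(t))+\int_0^t\mathcal Lh(x(\tau))d\tau\}=0$ holds; $\bar u^*$ is taken to be admissible. ''Maximizes'' means $J(u-u_0)\le J(\bar u^* )$ for all admissible $u-u_0$. *)

(* Defs.v *)
From mathcomp Require Import all_boot all_order all_algebra.
From mathcomp Require Import all_classical all_reals all_analysis.
From mathcomp Require Import measurable_realfun.

Set Implicit Arguments.
Unset Strict Implicit.
Unset Printing Implicit Defensive.

Import Order.TTheory GRing.Theory Num.Theory.
Import numFieldNormedType.Exports.

Local Open Scope classical_set_scope.
Local Open Scope ring_scope.

Section matrices.
Context {R : realType}.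

(* On rows and columns this is the Euclidean norm; the norm [`|A|] of the
   library is the sup norm of the entries. *)
Definition frob {a b : nat} (A : 'M[R]_(a, b)) : R := Num.sqrt (\tr (A^T *m A)).

Definition nonneg_def {k : nat} (A : 'M[R]_k) : Prop :=
  A^T = A /\ forall v : 'cV[R]_k, 0 <= (v^T *m A *m v) 0 0.

Definition pos_def {k : nat} (A : 'M[R]_k) : Prop :=
  A^T = A /\ forall v : 'cV[R]_k, v != 0 -> 0 < (v^T *m A *m v) 0 0.

(* The nonnegative definite square root, which exists and is unique when [A]
   is nonnegative definite. *)
Definition sqrtmx {k : nat} (A : 'M[R]_k) : 'M[R]_k :=
  xget 0 [set S : 'M[R]_k | nonneg_def S /\ S *m S = A].

Definition locally_lipschitz {V W : normedModType R} (F : V -> W) : Prop :=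
  forall x : V, exists k : R,
    \forall p \near (x, x), `|F p.1 - F p.2| <= k * `|p.1 - p.2|.

End matrices.

Section comparison_functions.
Context {R : realType}.

(* Functions on [0, oo[ are represented by total functions whose values on
   negative arguments are irrelevant. *)
Definition class_Kinfty (k : R -> R) : Prop :=
  [/\ k 0 = 0, {within `[0, +oo[, continuous k},
      (forall s t, 0 <= s -> s < t -> k s < k t) &
      (forall M, exists2 s, 0 <= s & M <= k s)].

Definition diff_quotient (k : R -> R) (s t : R) : R := (k t - k s) / (t - s).

(* Derivative relative to [0, oo[, hence one-sided at 0. *)
Definition hderivable (k : R -> R) : Prop :=
  forall s, 0 <= s ->
    cvg (diff_quotient k s t @[t --> within `[0, +oo[ s^']).

Definition hderive (k : R -> R) (s : R) : R :=
  lim (diff_quotient k s t @[t --> within `[0, +oo[ s^']).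

Definition Kinfty_with_Kinfty_derivative (k : R -> R) : Prop :=
  [/\ class_Kinfty k, hderivable k & class_Kinfty (hderive k)].

(* Inverse of a class K_infty function, meaningful on [0, oo[. *)
Definition Kinv (k : R -> R) (y : R) : R := xget 0 [set s | 0 <= s /\ k s = y].

Definition legendre_fenchel (gam : R -> R) (y : R) : R :=
  \int[lebesgue_measure]_(s in `[0, y]) Kinv (hderive gam) s.

End comparison_functions.

Section barrier.
Context {R : realType} {n : nat}.
Implicit Types (h : 'cV[R]_n -> R) (x : 'cV[R]_n).

Definition grad h x : 'rV[R]_n := \row_j 'D_(delta_mx j 0) h x.

Definition hess h x : 'M[R]_n :=
  \matrix_(i, j) 'D_(delta_mx i 0) (fun y => 'D_(delta_mx j 0) h y) x.

Definition twice_differentiable h : Prop :=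
  (forall x, differentiable h x) /\ (forall x, differentiable (grad h) x).

Definition inf_h h : \bar R := ereal_inf [set (h x)%:E | x in setT].
Definition sup_h h : \bar R := ereal_sup [set (h x)%:E | x in setT].

Definition NSSf_CBF_candidate h : Prop :=
  twice_differentiable h /\ (inf_h h < 0 < sup_h h)%E.

(* [alpha] is total, so that [alpha (h x)] makes sense also where [h] attains
   an extremum; there its value is unconstrained. *)
Definition class_K_h h (alpha : R -> R) : Prop :=
  let I := [set y : R | (inf_h h < y%:E < sup_h h)%E] in
  [/\ {within I, continuous alpha},
      (forall y z, I y -> I z -> y < z -> alpha y < alpha z) &
      alpha 0 = 0].

(* Derivative of [h] at [x] along the vector [b]. *)
Definition lie h x (b : 'cV[R]_n) : R := (grad h x *m b) 0 0.

Definition lieg {m : nat} h (g2 : 'cV[R]_n -> 'M[R]_(n, m)) x : 'rV[R]_m :=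
  grad h x *m g2 x.

Definition noise_hess {r : nat} h (g1 : 'cV[R]_n -> 'M[R]_(n, r)) x : 'M[R]_r :=
  (g1 x)^T *m hess h x *m g1 x.

(* Generator of dx = b(t, x) dt + g1(x) dw, E{dw dw^T} = S S^T dt. *)
Definition generator {r : nat} h (g1 : 'cV[R]_n -> 'M[R]_(n, r))
    (b : R -> 'cV[R]_n -> 'cV[R]_n) (S : R -> 'cV[R]_n -> 'M[R]_r)
    (t : R) x : R :=
  lie h x (b t x)
  + 2^-1 * \tr ((S t x)^T *m (g1 x)^T *m hess h x *m g1 x *m S t x).

Definition SBFc {r : nat} h (g1 : 'cV[R]_n -> 'M[R]_(n, r))
    (b : R -> 'cV[R]_n -> 'cV[R]_n) (S : R -> 'cV[R]_n -> 'M[R]_r) : Prop :=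
  exists2 alpha, class_K_h h alpha &
    forall t x, 0 <= t -> generator h g1 b S t x >= - alpha (h x).

Definition locally_bounded {r : nat} (S : R -> 'cV[R]_n -> 'M[R]_r) : Prop :=
  forall T rho : R, exists M : R, forall t x,
    0 <= t <= T -> frob x <= rho -> frob (S t x) <= M.

Definition covariances (r : nat) : set (R -> 'cV[R]_n -> 'M[R]_r) :=
  [set S | locally_bounded S /\ forall t x, nonneg_def (S t x)].

End barrier.

Section stochastic_systems.
Local Open Scope ereal_scope.
Context {R : realType} {d : measure_display} {Omega : measurableType d}.
Variable P : probability Omega R.
Implicit Types (F : R -> set (set Omega)) (w H I : R -> Omega -> R).

Definition measurable_wrt (G : set (set Omega)) (Y : Omega -> R) : Prop :=
  forall B : set R, measurable B -> G (Y @^-1` B).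

Definition adapted F w : Prop :=
  forall t, (0 <= t)%R -> measurable_wrt (F t) (w t).

Definition filtration F : Prop :=
  [/\ (forall t, (0 <= t)%R -> sigma_algebra setT (F t)),
      (forall t, (0 <= t)%R -> F t `<=` measurable) &
      (forall s t, (0 <= s)%R -> (s <= t)%R -> F s `<=` F t)].

Definition ae_continuous {V : topologicalType} (X : R -> Omega -> V) : Prop :=
  {ae P, forall om, {within `[0%R, +oo[, continuous (fun t => X t om)}}.

(* Standard r-dimensional Wiener process relative to [F]: W_t - W_s is
   independent of F_s, and its components are independent N(0, t - s). *)
Definition wiener {r : nat} F (W : R -> Omega -> 'cV[R]_r) : Prop :=
  [/\ {ae P, forall om, W 0%R om = 0%R},
      (forall i, adapted F (fun t om => W t om i ord0)),
      ae_continuous W &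
      forall s t, (0 <= s)%R -> (s < t)%R ->
      forall (A : set Omega) (B : 'I_r -> set R),
        F s A -> (forall i, measurable (B i)) ->
        P (A `&` [set om | forall i, B i (W t om i ord0 - W s om i ord0)%R]) =
        P A * \prod_(i < r) normal_prob 0%R (Num.sqrt (t - s)) (B i)].

Record simple_process := SimpleProcess {
  sp_size : nat;
  sp_time : nat -> R;
  sp_coef : nat -> Omega -> R }.

Definition sp_adapted F (S : simple_process) : Prop :=
  forall k, [/\ (0 <= sp_time S k <= sp_time S k.+1)%R,
    measurable_wrt (F (sp_time S k)) (sp_coef S k) &
    exists M, forall om, (`|sp_coef S k om| <= M)%R].

Definition sp_val (S : simple_process) (t : R) (om : Omega) : R :=
  (\sum_(k < sp_size S)
     sp_coef S k om * (sp_time S k < t <= sp_time S k.+1)%R%:R)%R.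

Definition sp_int w (S : simple_process) (t : R) (om : Omega) : R :=
  (\sum_(k < sp_size S) sp_coef S k om *
     (w (Num.min t (sp_time S k.+1)) om - w (Num.min t (sp_time S k)) om))%R.

Definition vanishes_in_probability (Z : nat -> Omega -> \bar R) : Prop :=
  forall e : R, (0 < e)%R -> P [set om | e%:E < Z k om] @[k --> \oo] --> 0.

(* [I] is a continuous version of the Ito integral of [H] against [w]: the
   limit in probability of the integrals of simple processes S_k such that
   \int_0^t (H - S_k)^2 ds tends to 0 in probability for every t. *)
Definition ito_integral F w H I : Prop :=
  [/\ adapted F H,
      measurable_fun [set p : measurableTypeR R * Omega | (0 <= p.1)%R]
        (fun p => H p.1 p.2),
      ae_continuous I &
      exists S : nat -> simple_process,
        [/\ (forall k, sp_adapted F (S k)),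
            (forall t, (0 <= t)%R -> vanishes_in_probability (fun k om =>
               \int[lebesgue_measure]_(s in `[0%R, t])
                 ((H s om - sp_val (S k) s om) ^+ 2)%:E)) &
            (forall t, (0 <= t)%R -> vanishes_in_probability (fun k om =>
               `|sp_int w (S k) t om - I t om|%:E))]].

(* [X] solves dX = b(t, X) dt + D(t, X) dW, X_0 = xi, on [0, oo[. *)
Definition solution {n r : nat} F (W : R -> Omega -> 'cV[R]_r)
    (xi : Omega -> 'cV[R]_n) (b : R -> 'cV[R]_n -> 'cV[R]_n)
    (D : R -> 'cV[R]_n -> 'M[R]_(n, r)) (X : R -> Omega -> 'cV[R]_n) : Prop :=
  [/\ (forall i, adapted F (fun t om => X t om i ord0)),
      ae_continuous X,
      {ae P, forall om, X 0%R om = xi om},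
      {ae P, forall om, forall i t, (0 <= t)%R ->
         lebesgue_measure.-integrable `[0%R, t]
           (fun s => (b s (X s om) i ord0)%:E)} &
      exists I : 'I_n -> 'I_r -> R -> Omega -> R,
        (forall i j, ito_integral F (fun t om => W t om j ord0)
                       (fun t om => D t (X t om) i j) (I i j)) /\
        {ae P, forall om, forall i t, (0 <= t)%R -> X t om i ord0 =
          (xi om i ord0
           + (\int[lebesgue_measure]_(s in `[0, t]) b s (X s om) i ord0)
           + \sum_(j < r) I i j t om)%R}].

(* The integral of [g] over [A] exists in the extended reals. *)
Definition has_integral {d' : measure_display} {T : measurableType d'}
    (mu : {measure set T -> \bar R}) (A : set T) (g : T -> \bar R) : Prop :=
  measurable_fun A g /\
  (\int[mu]_(x in A) (g^\+ x) < +oo \/ \int[mu]_(x in A) (g^\- x) < +oo).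

Definition dynkin_formula {n : nat} (h : 'cV[R]_n -> R) (Lh : R -> 'cV[R]_n -> R)
    (X : R -> Omega -> 'cV[R]_n) : Prop :=
  forall t, (0 <= t)%R ->
    let Y om := (h (X 0 om) - h (X t om)
      + \int[lebesgue_measure]_(s in `[0, t]) Lh s (X s om))%R in
    [/\ {ae P, forall om, lebesgue_measure.-integrable `[0%R, t]
           (fun s => (Lh s (X s om))%:E)},
        P.-integrable setT (fun om => (Y om)%:E) &
        \int[P]_om (Y om)%:E = 0].

End stochastic_systems.

Section inverse_optimality.
Context {R : realType} {n m r : nat}.
Variables (f : 'cV[R]_n -> 'cV[R]_n) (g1 : 'cV[R]_n -> 'M[R]_(n, r))
  (g2 : 'cV[R]_n -> 'M[R]_(n, m)) (h : 'cV[R]_n -> R)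
  (R2 : 'cV[R]_n -> 'cV[R]_m -> 'M[R]_m) (gam1 gam2 : R -> R)
  (u0 : R -> 'cV[R]_n -> 'cV[R]_m).
Implicit Types (x : 'cV[R]_n) (u : 'cV[R]_m) (v : R -> 'cV[R]_n -> 'cV[R]_m)
  (S : R -> 'cV[R]_n -> 'M[R]_r).

Definition noise_size x : R := frob (noise_hess h g1 x).

Definition control_size x u : R := frob (lieg h g2 x *m invmx (sqrtmx (R2 x u))).

(* Here and below division by zero yields zero, which is the intended value of
   the ratio. *)
Definition ubar x u : 'cV[R]_m :=
  (legendre_fenchel gam2 (control_size x u) / control_size x u ^+ 2)
    *: (invmx (R2 x u) *m (lieg h g2 x)^T).

Definition ubar_star (beta : R) x u : 'cV[R]_m :=
  (beta / 2 * (Kinv (hderive gam2) (control_size x u) / control_size x u))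
    *: (invmx (R2 x u) *m (lieg h g2 x)^T).

(* The incremental covariance of the auxiliary noise. *)
Definition aux_covariance x : 'M[R]_r :=
  (- 2 * (legendre_fenchel gam1 (noise_size x) / noise_size x ^+ 2))
    *: noise_hess h g1 x.

(* Covariances of the same form as the auxiliary one, which corresponds to
   [rho s = 2 * legendre_fenchel gam1 s / s]. *)
Definition of_auxiliary_form (S : 'cV[R]_n -> 'M[R]_r) : Prop :=
  exists2 rho, class_Kinfty rho &
    forall x, S x *m (S x)^T =
      (- (rho (noise_size x) / noise_size x)) *: noise_hess h g1 x.

Definition barrier_margin x u : R :=
  lie h x (f x + g2 x *m u) - legendre_fenchel gam1 (noise_size x)
  + legendre_fenchel gam2 (control_size x u).

Definition closed_loop v (t : R) x : 'cV[R]_n := f x + g2 x *m (u0 t x + v t x).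

Variables beta lambda : R.

Definition state_cost x u : R :=
  - 2 * beta * barrier_margin x u
  - beta * (beta - 2) * legendre_fenchel gam2 (control_size x u)
  - beta * (2 - lambda) * legendre_fenchel gam1 (noise_size x).

Definition running_cost v S (t : R) x : R :=
  state_cost x (u0 t x)
  - beta ^+ 2 * gam2 (2 / beta * frob (sqrtmx (R2 x (u0 t x)) *m v t x))
  + beta * lambda * gam1 (frob (S t x *m (S t x)^T) / lambda).

Context {d : measure_display} {Omega : measurableType d}.
Variables (P : probability Omega R) (F : R -> set (set Omega))
  (W : R -> Omega -> 'cV[R]_r) (xi : Omega -> 'cV[R]_n).
Implicit Types X : R -> Omega -> 'cV[R]_n.

(* dX = f dt + g1 dw + g2 u dt with u = u0 + v and dw = S dW. *)
Definition closed_loop_solution v S X : Prop :=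
  solution P F W xi (closed_loop v) (fun t x => g1 x *m S t x) X.

Definition path_running_cost v S X (t : R) (om : Omega) : \bar R :=
  \int[lebesgue_measure]_(s in `[0%R, t]) (running_cost v S s (X s om))%:E.

Definition path_cost v S X (t : R) (om : Omega) : \bar R :=
  ((2 * beta * h (X t om))%:E + path_running_cost v S X t om)%E.

Definition expected_cost v S X (t : R) : \bar R :=
  \int[P]_om path_cost v S X t om.

(* The covariances considered: a subclass of [covariances r], possibly all of
   it. Closed-loop solutions are only required for these, because for some
   locally bounded coefficients there is no solution at all: for instance
   dx = 1_{x = 0} dW with x(0) = 0 has none. *)
Variable C : set (R -> 'cV[R]_n -> 'M[R]_r).

(* [v] stands for u - u_0. *)
Definition admissible v : Prop :=
  forall S, C S ->
    (exists X, closed_loop_solution v S X) /\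
    forall X, closed_loop_solution v S X ->
      [/\ (forall t, 0 <= t ->
             {ae P, forall om, has_integral lebesgue_measure `[0, t]
                (fun s => (running_cost v S s (X s om))%:E)} /\
             has_integral P setT (path_cost v S X t)),
          cvg (expected_cost v S X t @[t --> +oo]) &
          dynkin_formula P h (generator h g1 (closed_loop v) S) X].

(* The infimum also ranges over the solutions of the closed loop, which need
   not be unique. *)
Definition J v : \bar R :=
  ereal_inf [set c | exists S X, [/\ C S, closed_loop_solution v S X &
                       expected_cost v S X t @[t --> +oo] --> c]].

End inverse_optimality.

(* Main.v *)
Require Import Defs.
From mathcomp Require Import all_boot all_order all_algebra.
From mathcomp Require Import all_classical all_reals all_analysis.
From mathcomp Require Import measurable_realfun.
From mathcomp Require Import spectral ring lra.
From mathcomp Require complex.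

(* Write [N] for the Frobenius norm of the noise Hessian [A = g1^T h'' g1] and
   [c] for the size of [L_{g2} h].  Along any closed loop the running cost equals
     - 2 beta Lh + beta Q1 - beta ^ 2 Q2,
   where [Q1 >= 0] is the gap of the Young inequality for [gam1] (combined with
   Cauchy-Schwarz for [Tr (Sigma^T A Sigma)]) and [Q2 >= 0] the gap of the Young
   inequality for [gam2] (combined with Cauchy-Schwarz for [L_{g2} h (u - u_0)]).
   The control [ubar_star] makes [Q2 = 0], and the covariance
     Sigma Sigma^T = - lambda (gam1')^-1(N) / N A
   makes [Q1 = 0]; it exists because it is a rescaling of the auxiliary one.  By
   Dynkin's formula the expected cost at any time is thus at most
   [2 beta E h(x(0))] for every control under the latter covariance, and at
   least [2 beta E h(x(0))] for [ubar_star] under every covariance. *)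

Import Order.TTheory GRing.Theory Num.Theory.
Import numFieldNormedType.Exports.

Local Open Scope classical_set_scope.
Local Open Scope ring_scope.

(** * Class K_infty functions and the Legendre-Fenchel transform *)

Section class_Kinfty.
Context {R : realType}.
Implicit Types (k gam : R -> R) (s t y z : R).

Lemma Kinfty_ltE {k s t} : class_Kinfty k -> 0 <= s -> 0 <= t ->
  (k s < k t) = (s < t).
Proof.
move=> [_ _ mono _] s0 t0; case: (ltgtP s t) => [st|ts|->].
- exact: mono.
- by apply/negbTE; rewrite -leNgt ltW// mono.
- by rewrite ltxx.
Qed.

Lemma Kinfty_leE {k s t} : class_Kinfty k -> 0 <= s -> 0 <= t ->
  (k s <= k t) = (s <= t).
Proof. by move=> kK s0 t0; rewrite !leNgt (Kinfty_ltE kK). Qed.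

Lemma Kinfty_ge0 {k s} : class_Kinfty k -> 0 <= s -> 0 <= k s.
Proof. by move=> kK s0; have [<- _ _ _] := kK; rewrite (Kinfty_leE kK). Qed.

(** Intermediate value theorem on [[0, S]], where unboundedness of [k] supplies [S]. *)
Lemma Kinv_spec {k y} : class_Kinfty k -> 0 <= y ->
  0 <= Kinv k y /\ k (Kinv k y) = y.
Proof.
move=> kK y0; have [k0 kc _ kub] := kK.
have [S S0 yS] := kub y.
have kc' : {within `[0, S], continuous k}.
  by apply: continuous_subspaceW kc => x /=; rewrite !in_itv/= andbT => /andP[].
have kS : k 0 <= k S by rewrite (Kinfty_leE kK).
have [|c] := IVT S0 kc' (v := y).
  by rewrite min_l// max_r// k0 y0.
rewrite in_itv/= => /andP[c0 _] kc_y.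
by apply: (@xgetPex R 0 [set s | 0 <= s /\ k s = y]); exists c.
Qed.

Lemma Kinv_ge0 {k y} : class_Kinfty k -> 0 <= y -> 0 <= Kinv k y.
Proof. by move=> kK /(Kinv_spec kK)[]. Qed.

Lemma KinvK {k y} : class_Kinfty k -> 0 <= y -> k (Kinv k y) = y.
Proof. by move=> kK /(Kinv_spec kK)[]. Qed.

Lemma KinftyK {k s} : class_Kinfty k -> 0 <= s -> Kinv k (k s) = s.
Proof.
move=> kK s0; have [? kks] := Kinv_spec kK (Kinfty_ge0 kK s0).
by apply/le_anti/andP; split; rewrite -(Kinfty_leE kK)// kks.
Qed.

Lemma Kinv_lt {k y s} : class_Kinfty k -> 0 <= y -> 0 <= s ->
  (Kinv k y < s) = (y < k s).
Proof. by move=> kK y0 s0; rewrite -(Kinfty_ltE kK) ?Kinv_ge0// KinvK. Qed.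

Lemma Kinv_gt {k y s} : class_Kinfty k -> 0 <= y -> 0 <= s ->
  (s < Kinv k y) = (k s < y).
Proof. by move=> kK y0 s0; rewrite -(Kinfty_ltE kK) ?Kinv_ge0// KinvK. Qed.

(** Through [Kinv_lt] and [Kinv_gt], continuity of the inverse reduces to strict inequalities
    between [z] and values of [k], which are open conditions on [z]. *)
Lemma class_Kinfty_Kinv {k} : class_Kinfty k -> class_Kinfty (Kinv k).
Proof.
move=> kK; have [k0 _ _ _] := kK; split.
- by rewrite -{1}k0 KinftyK.
- apply/subspace_continuousP => y /=; rewrite in_itv/= andbT => y0.
  have ky0 := Kinv_ge0 kK y0.
  apply/cvgrPdist_lt => e e0.
  have yub : y < k (Kinv k y + e) by rewrite -Kinv_lt// ?ltrDl// addr_ge0// ltW.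
  have h1 : \forall z \near y, z < k (Kinv k y + e).
    exact: lt_nbhsl.
  have h2 : \forall z \near y, 0 <= z -> Kinv k y - e < Kinv k z.
    (* [k] is uncontrolled on negative arguments, so a negative [Kinv k y - e] is treated apart. *)
    have [ye|ye] := ltP (Kinv k y) e.
      by near=> z => z0; apply: lt_le_trans (Kinv_ge0 kK z0); rewrite subr_lt0.
    have ye0 : 0 <= Kinv k y - e by rewrite subr_ge0.
    have ylb : k (Kinv k y - e) < y by rewrite -Kinv_gt// ltrBlDr ltrDl.
    near=> z => z0; rewrite Kinv_gt//; near: z.
    exact: lt_nbhsr.
  rewrite near_withinE; near=> z; rewrite /= in_itv/= andbT => z0.
  rewrite ltr_distlC; apply/andP; split; first by move: z0; near: z.
  by rewrite Kinv_lt ?addr_ge0// 1?ltW//; near: z.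
- by move=> s t s0 st; rewrite Kinv_lt// ?Kinv_ge0// ?KinvK//; apply: ltW;
    apply: le_lt_trans st.
- move=> M; exists (k (Num.max M 0)); last by rewrite KinftyK// ?le_max ?lexx// orbT.
  by rewrite (Kinfty_ge0 kK)// le_max lexx orbT.
Unshelve. all: by end_near. Qed.

End class_Kinfty.

(** * The Legendre-Fenchel transform as a convex conjugate *)

Section legendre_fenchel.
Context {R : realType} {gam : R -> R}.
Hypothesis gamK : Kinfty_with_Kinfty_derivative gam.
Let gam' := hderive gam.
Let k := Kinv gam'.
Let gam'K : class_Kinfty gam'. Proof. by case: gamK. Qed.
Let kK : class_Kinfty k. Proof. exact: class_Kinfty_Kinv. Qed.

(** Points at distance less than [s] from [s] are nonnegative, so there the quotient relative to
    [[0, +oo[] is the ordinary one. *)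
Lemma hderive_is_derive {s : R} : 0 < s -> is_derive s 1 gam (gam' s).
Proof.
move=> s0; have [_ dg _] := gamK.
have /cvgrPdist_lt dq : diff_quotient gam s t @[t --> within `[0, +oo[ s^'] --> gam' s.
  exact: dg (ltW s0).
have dq' : h^-1 *: ((gam \o shift s) (h *: 1) - gam s) @[h --> 0^'] --> gam' s.
  apply/cvgrPdist_lt => e e0.
  have [e1 /= e10 he1] := dq _ e0.
  exists (Num.min e1 s) => /=; first by rewrite lt_min e10.
  move=> h; rewrite /ball_ /= sub0r normrN lt_min => /andP[he hs] h0.
  have := he1 (h + s); rewrite /ball_ /= opprD addrCA subrr addr0 normrN.
  rewrite -subr_eq0 addrK => /(_ he h0).
  rewrite /= in_itv/= andbT.
  move: hs; rewrite ltr_norml => /andP[hs _].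
  rewrite -lerBlDr sub0r (ltW hs) => /(_ isT).
  by rewrite /diff_quotient addrK /GRing.scale /= mulr1 mulrC.
apply: DeriveDef; first by apply/cvg_ex; exists (gam' s).
exact: cvg_lim dq'.
Qed.

(** Convexity of [gam]: the mean value theorem combined with monotonicity of [gam']. *)
Lemma Kinfty_tangent {s t : R} : 0 <= s -> 0 <= t ->
  gam s + gam' s * (t - s) <= gam t.
Proof.
have mvt a b : 0 <= a -> a < b -> exists2 c, a < c < b & gam b - gam a = gam' c * (b - a).
  move=> a0 ab; have [[_ gc _ _] _ _] := gamK.
  have [||c] := @MVT R gam gam' a b ab.
  - move=> x; rewrite in_itv/= => /andP[ax _]; apply: hderive_is_derive.
    exact: le_lt_trans ax.
  - apply: continuous_subspaceW gc => x /=; rewrite !in_itv/= andbT => /andP[+ _].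
    exact: le_trans.
  - by rewrite in_itv/=; exists c.
move=> s0 t0; rewrite addrC -lerBrDr.
have [st|ts|->] := ltgtP s t; last by rewrite !subrr mulr0.
- have [c /andP[sc ct] ->] := mvt _ _ s0 st.
  rewrite ler_wpM2r ?subr_ge0 ?(ltW st)// (Kinfty_leE gam'K)// ?(ltW sc)//.
  exact: le_trans (ltW sc).
- have [c /andP[tc cs]] := mvt _ _ t0 ts.
  rewrite -[gam t - gam s]opprB -[t - s]opprB mulrN => ->; rewrite lerN2.
  rewrite ler_wpM2r ?subr_ge0 ?(ltW ts)// (Kinfty_leE gam'K)// ?(ltW cs)//.
  exact: le_trans (ltW tc).
Qed.

(** Convex conjugate in closed form: [s * y - gam s] is maximal at [s = k y]. Showing that [Phi] is
    a primitive of [k] identifies it with [legendre_fenchel gam]. *)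
Let Phi (y : R) := y * k y - gam (k y).

Let young_Phi {s y : R} : 0 <= s -> 0 <= y -> s * y <= gam s + Phi y.
Proof.
move=> s0 y0; have := Kinfty_tangent (Kinv_ge0 gam'K y0) s0.
rewrite (KinvK gam'K)// /Phi -/k; lra.
Qed.

(** Young's inequality at [s = k y] makes [k y] a subgradient of [Phi] at [y]. *)
Let Phi_le {y z : R} : 0 <= y -> 0 <= z -> (z - y) * k y <= Phi z - Phi y.
Proof.
move=> y0 z0; have := young_Phi (Kinv_ge0 gam'K y0) z0.
rewrite /Phi -/k; lra.
Qed.

Let Phi0 : Phi 0 = 0.
Proof.
have [[g0 _ _ _] _ _] := gamK; have [k0 _ _ _] := kK.
by rewrite /Phi mul0r k0 g0 subr0.
Qed.

Let k_cvg {y : R} : 0 < y -> k z @[z --> y] --> k y.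
Proof.
move=> y0; have [_ + _ _] := kK => /subspace_continuousP/(_ y)/=.
rewrite in_itv/= andbT ltW// => /(_ isT) kc.
rewrite /= within_interior// in kc.
rewrite interior_itv//=.
by rewrite in_itv/= y0.
Qed.

(** The subgradient inequalities at [y] and [h + y] trap the difference quotient between [k y] and
    [k (h + y)], and [k] is continuous. *)
Let Phi_derive {y : R} : 0 < y -> is_derive y 1 Phi (k y).
Proof.
move=> y0.
have /cvgrPdist_lt kc := k_cvg y0.
have dP : h^-1 *: ((Phi \o shift y) (h *: 1) - Phi y) @[h --> 0^'] --> k y.
  apply/cvgrPdist_lt => e e0.
  have [e1 /= e10 he1] := kc _ e0.
  exists (Num.min e1 y) => /=; first by rewrite lt_min e10.
  move=> h; rewrite /ball_ /= sub0r normrN lt_min => /andP[he hy] h0.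
  have := he1 (h + y); rewrite /ball_ /= opprD addrCA subrr addr0 normrN.
  move=> /(_ he).
  have hy0 : 0 <= h + y.
    by move: hy; rewrite ltr_norml => /andP[hy _]; rewrite -lerBlDr sub0r ltW.
  have := Phi_le (ltW y0) hy0; have := Phi_le hy0 (ltW y0).
  rewrite addrK opprD addrCA subrr addr0 /GRing.scale /= mulr1.
  set q := h^-1 * _ => P1 P2.
  have qE : Phi (h + y) - Phi y = q * h by rewrite /q mulrC mulrA divff// mul1r.
  rewrite -opprB qE in P1; rewrite qE in P2.
  rewrite !ltr_norml => /andP[k1 k2].
  have [hp|hn] := ltP 0 h.
    have : k y <= q by move: P2; rewrite mulrC ler_pM2r.
    have : q <= k (h + y).
      by move: P1; rewrite mulNr lerN2 mulrC ler_pM2l.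
    move=> ? ?; apply/andP; split; lra.
  have {}hn : h < 0 by rewrite lt_neqAle h0.
  have : q <= k y by move: P2; rewrite mulrC ler_nM2r.
  have : k (h + y) <= q.
    by move: P1; rewrite mulNr lerN2 mulrC ler_nM2l.
  move=> ? ?; apply/andP; split; lra.
apply: DeriveDef; first by apply/cvg_ex; exists (k y).
exact: cvg_lim dP.
Qed.

Let Phi_right0 : Phi z @[z --> 0^'+] --> Phi 0.
Proof.
have k1 : 0 <= k 1 by rewrite Kinv_ge0.
rewrite Phi0; apply/cvgrPdist_lt => e e0; near=> z.
have z0 : 0 < z by [].
have z1 : z <= 1 by near: z; apply: nbhs_right_le.
(* [Phi z] is at most [z * k z], hence at most [z * k 1]; the added 1 makes the divisor positive. *)
have ze : z * (k 1 + 1) < e.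
  rewrite -ltr_pdivlMr ?ltr_wpDl//; near: z; apply: nbhs_right_lt.
  by rewrite divr_gt0// ltr_wpDl.
have Pz := Phi_le (lexx 0) (ltW z0).
have Pz' := Phi_le (ltW z0) (lexx 0).
have [k0 _ _ _] := kK.
rewrite Phi0 k0 mulr0 subr0 in Pz; rewrite Phi0 !sub0r mulNr lerN2 in Pz'.
rewrite sub0r normrN ger0_norm//; apply: le_lt_trans ze.
apply: le_trans Pz' _; apply: ler_wpM2l; first exact: ltW.
apply: (@le_trans _ _ (k 1)); last by rewrite lerDl.
by rewrite (Kinfty_leE kK)// ltW.
Unshelve. all: by end_near. Qed.

(** Fundamental theorem of calculus with primitive [Phi], whose continuity at the endpoint 0 is
    [Phi_right0]. *)
Lemma legendre_fenchelE {y : R} : 0 <= y ->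
  legendre_fenchel gam y = y * k y - gam (k y).
Proof.
rewrite le_eqVlt => /predU1P[<-|y0].
  rewrite -/(Phi 0) Phi0 /legendre_fenchel set_itv1 /Rintegral.
  by rewrite integral_set1.
rewrite -/(Phi y) /legendre_fenchel /Rintegral.
rewrite (@continuous_FTC2 _ k Phi 0 y)//.
- by rewrite Phi0 sube0.
- have [_ + _ _] := kK; apply: continuous_subspaceW => x /=.
  by rewrite !in_itv/= andbT => /andP[].
- split=> //.
  + by move=> x; rewrite in_itv/= => /andP[x0 _]; have [] := Phi_derive x0.
  + apply: cvg_at_left_filter.
    apply: differentiable_continuous; apply/derivable1_diffP.
    by have [] := Phi_derive y0.
- move=> x; rewrite in_itv/= => /andP[x0 _].
  by rewrite derive1E; have [] := Phi_derive x0.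
Qed.

Lemma young_legendre_fenchel {s y : R} : 0 <= s -> 0 <= y ->
  s * y <= gam s + legendre_fenchel gam y.
Proof. by move=> s0 y0; rewrite legendre_fenchelE//; exact: young_Phi. Qed.

Lemma legendre_fenchel_ge0 {y : R} : 0 <= y -> 0 <= legendre_fenchel gam y.
Proof.
move=> y0; have [[g0 _ _ _] _ _] := gamK.
by have := young_legendre_fenchel (lexx 0) y0; rewrite mul0r g0 add0r.
Qed.

(** Subgradient inequality from [y / 2] to [y], where [Phi (y / 2) >= 0]. It gives strict positivity
    of the transform and, later, a bound on the noise Hessian in terms of [Sigma_bar]. *)
Lemma legendre_fenchel_ge_half {y : R} : 0 <= y ->
  y / 2 * k (y / 2) <= legendre_fenchel gam y.
Proof.
move=> y0; have y20 : 0 <= y / 2 by rewrite divr_ge0.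
have := Phi_le y20 y0; have := legendre_fenchel_ge0 y20.
rewrite !legendre_fenchelE// -/(Phi _) -/(Phi _).
by rewrite [y in y - _]splitr addrK => ? ?; lra.
Qed.

Lemma legendre_fenchel_gt0 {y : R} : 0 < y -> 0 < legendre_fenchel gam y.
Proof.
move=> y0; apply: lt_le_trans (legendre_fenchel_ge_half (ltW y0)).
have y20 : 0 < y / 2 by rewrite divr_gt0.
by have [k0 _ km _] := kK; rewrite mulr_gt0// -k0 km.
Qed.

End legendre_fenchel.

(** * Square roots of positive definite matrices *)

Section pos_def_sqrt.
Import complex.

(** Each new point is corrected by a multiple of the polynomial vanishing at the others. This lets a
    function of the eigenvalues act on a matrix as a polynomial. *)
Lemma poly_interpolation {K : fieldType} (g : K -> K) (s : seq K) :
  exists p : {poly K}, forall x, x \in s -> p.[x] = g x.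
Proof.
elim: s => [|a s [p ps]]; first by exists 0.
have [as_|as_] := boolP (a \in s).
  by exists p => x; rewrite inE => /orP[/eqP->|]; exact: ps.
pose q := \prod_(y <- s) ('X - y%:P).
have qs x : (q.[x] == 0) = (x \in s) by rewrite -root_prod_XsubC.
exists (p + ((g a - p.[a]) / q.[a]) *: q) => x.
rewrite inE !hornerE => /orP[/eqP->|xs].
  by rewrite divfK ?qs// addrC subrK.
by have /eqP-> := etrans (qs x) xs; rewrite mulr0 addr0 ps.
Qed.

Lemma trmx_horner_mx {K : comNzRingType} {n : nat} (A : 'M[K]_n.+1) (p : {poly K}) :
  (horner_mx A p)^T = horner_mx A^T p.
Proof.
elim/poly_ind: p => [|p c IHp]; first by rewrite !rmorph0 trmx0.
rewrite [in LHS]rmorphD [in LHS]rmorphM [in RHS]mulrC !rmorphD !rmorphM /= !horner_mx_X !horner_mx_C.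
by rewrite raddfD /= tr_scalar_mx trmx_mul IHp.
Qed.

(** Evaluation of [p] commutes with [g] and with conjugation by [P]; injectivity of [map_mx g]
    brings the identity back to [K]. *)
Lemma horner_mx_fixed_conj {K L : fieldType} (g : {rmorphism K -> L}) {n : nat}
    (A D : 'M[K]_n.+1) (P : 'M[L]_n.+1) (p : {poly K}) : P \in unitmx ->
  map_mx g A = invmx P *m map_mx g D *m P -> horner_mx D p = D ->
  horner_mx A p = A.
Proof.
move=> Pu AE Dp; apply: (@map_mx_inj _ _ g).
by rewrite map_horner_mx AE horner_mx_uconjC// -map_horner_mx Dp.
Qed.

(** Spectral theorem for [A] seen as a Hermitian matrix, whose eigenvalues are real; [P] stays
    complex. *)
Lemma realsym_diagonalizable {R : rcfType} {n : nat} {A : 'M[R]_n} : A^T = A ->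
  exists (P : 'M[complex.complex R]_n) (D : 'rV[R]_n), P \in unitmx /\
   map_mx (complex.real_complex R) A =
     invmx P *m map_mx (complex.real_complex R) (diag_mx D) *m P.
Proof.
move=> symA; set AC := map_mx _ A.
have hermA : AC \is hermsymmx.
  apply: realsym_hermsym.
    by apply/is_hermitianmxP; rewrite expr0 scale1r map_mx_id// map_trmx symA.
  apply/mxOverP => i j; rewrite mxE; apply/complex.complex_realP.
  by exists (A i j).
have /orthomx_spectralP AE := hermitian_normalmx hermA.
have Dreal := hermitian_spectral_diag_real hermA.
exists (spectralmx AC), (map_mx (@complex.Re R) (spectral_diag AC)).
split; first exact: spectral_unit.
rewrite [LHS]AE map_diag_mx.
suff <- : spectral_diag AC =
    map_mx (real_complex R) (map_mx (@complex.Re R) (spectral_diag AC)) by [].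
by apply/rowP => j; rewrite !mxE; apply/esym/RRe_real/mxOverP.
Qed.

Lemma pos_def_eigenvalue {R : realType} {n : nat} {A : 'M[R]_n} {a : R} :
  pos_def A -> eigenvalue A a -> 0 <= a.
Proof.
move=> [_ posA] /eigenvalueP[v vA v0].
have vT0 : v^T != 0 by rewrite -[v]trmxK trmxK trmx_eq0.
have := posA _ vT0.
rewrite trmxK vA -scalemxAl mxE => h.
have : 0 <= (v *m v^T) 0 0.
  by rewrite mxE sumr_ge0// => i _; rewrite mxE -expr2 sqr_ge0.
rewrite le_eqVlt => /predU1P[e|e]; first by rewrite -e mulr0 ltxx in h.
by rewrite ltW//; move: h; rewrite pmulr_lgt0.
Qed.

(** If [p] interpolates the fourth root on the eigenvalues, then [p(A)^4 = A] and [S = p(A)^2]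
    works. The fourth root is chosen because [S] is then [p(A)^T p(A)], visibly nonnegative
    definite. *)
Lemma pos_def_sqrt {R : realType} {n : nat} {A : 'M[R]_n} : pos_def A ->
  exists S : 'M[R]_n, nonneg_def S /\ S *m S = A.
Proof.
move=> posA; have [symA _] := posA.
(* Polynomials are evaluated at matrices of size [n.+1], so size 0 is settled apart. *)
case: n A posA symA => [|n] A posA symA.
  exists 0; split; last by rewrite mulmx0 [A]flatmx0.
  by split => [|v]; [rewrite trmx0|rewrite mulmx0 mul0mx mxE].
have [P [D [Punit AE]]] := realsym_diagonalizable symA.
have D0 i : 0 <= D 0 i.
  apply: (pos_def_eigenvalue posA).
  (* The characteristic polynomial carries the claim to the complex numbers, where row [i] of [P] is
     a left eigenvector for [D 0 i]. *)
  rewrite eigenvalue_root_char -(fmorph_root (real_complex R)).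
  rewrite map_char_poly -eigenvalue_root_char AE.
  apply/eigenvalueP; exists (row i P).
    rewrite -row_mul mulmxA mulKVmx// map_diag_mx row_mul row_diag_mx.
    by rewrite mxE -scalemxAl -rowE.
  apply/eqP => rP0; have := row_mul i P (invmx P).
  rewrite rP0 mul0mx mulmxV// => /rowP/(_ i).
  by rewrite !mxE eqxx => /eqP; rewrite oner_eq0.
pose g (x : R) := Num.sqrt (Num.sqrt x) : R.
have [p pE] := poly_interpolation g [seq D 0 i | i <- enum 'I_n.+1].
have pD : horner_mx (diag_mx D) (p ^+ 4) = diag_mx D.
  rewrite horner_mx_diag; congr diag_mx; apply/rowP => i; rewrite !mxE.
  rewrite horner_exp pE ?map_f ?mem_enum//.
  by rewrite (exprM _ 2 2) !sqr_sqrtr ?sqrtr_ge0.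
have pA : horner_mx A (p ^+ 4) = A by exact: horner_mx_fixed_conj Punit AE pD.
exists (horner_mx A (p ^+ 2)); split; last first.
  transitivity (horner_mx A (p ^+ 2) * horner_mx A (p ^+ 2)) => //.
  by rewrite -rmorphM -exprD; exact: pA.
split => [|v]; first by rewrite trmx_horner_mx symA.
rewrite rmorphXn /= expr2 [_ * _]/(_ *m _) mulmxA -mulmxA.
rewrite -{1}[horner_mx A p]trmxK trmx_horner_mx symA -trmx_mul.
by rewrite mxE sumr_ge0// => i _; rewrite mxE -expr2 sqr_ge0.
Qed.

End pos_def_sqrt.

(** * The Frobenius norm *)

Section frobenius.
Context {R : realType}.

Lemma mxtrace_trmul {a b : nat} (A B : 'M[R]_(a, b)) :
  \tr (A^T *m B) = \sum_i \sum_j A i j * B i j.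
Proof.
rewrite exchange_big; apply: eq_bigr => j _.
by rewrite mxE; apply: eq_bigr => i _; rewrite mxE.
Qed.

Lemma frob_sqr {a b : nat} (A : 'M[R]_(a, b)) : frob A ^+ 2 = \tr (A^T *m A).
Proof.
rewrite sqr_sqrtr// mxtrace_trmul.
by apply: sumr_ge0 => i _; apply: sumr_ge0 => j _; rewrite -expr2 sqr_ge0.
Qed.

Lemma frob_ge0 {a b : nat} (A : 'M[R]_(a, b)) : 0 <= frob A.
Proof. exact: sqrtr_ge0. Qed.

Lemma frob0_eq0 {a b : nat} {A : 'M[R]_(a, b)} : frob A = 0 -> A = 0.
Proof.
move=> A0; have /eqP := frob_sqr A; rewrite A0 expr0n/= mxtrace_trmul.
have sq0 i j : 0 <= A i j * A i j by rewrite -expr2 sqr_ge0.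
rewrite eq_sym psumr_eq0 => [|i _]; last exact: sumr_ge0.
move=> /allP h; apply/matrixP => i j; rewrite mxE.
have := h i (mem_index_enum _); rewrite psumr_eq0// => /allP/(_ j (mem_index_enum _)).
by rewrite mulf_eq0 orbb => /eqP.
Qed.

Lemma frobZ {a b : nat} (c : R) (A : 'M[R]_(a, b)) : frob (c *: A) = `|c| * frob A.
Proof.
rewrite /frob [(c *: A)^T]linearZ -scalemxAl -scalemxAr !linearZ /= mulrA -expr2.
by rewrite sqrtrM ?sqr_ge0// sqrtr_sqr.
Qed.

Lemma frobN {a b : nat} (A : 'M[R]_(a, b)) : frob (- A) = frob A.
Proof. by rewrite -scaleN1r frobZ normrN1 mul1r. Qed.

Lemma frob_tr {a b : nat} (A : 'M[R]_(a, b)) : frob A^T = frob A.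
Proof. by rewrite /frob trmxK mxtrace_mulC. Qed.

(** Expanding the squared norm of [frob B *: A - frob A *: B] leaves [2 * (frob A * frob B)] times
    the difference of the two sides; this factor is positive outside the zero cases. *)
Lemma frob_CauchySchwarz {a b : nat} (A B : 'M[R]_(a, b)) :
  \tr (A^T *m B) <= frob A * frob B.
Proof.
have := frob_ge0 A; rewrite le_eqVlt => /predU1P[/esym A0|A0].
  by rewrite A0 (frob0_eq0 A0) trmx0 mul0mx linear0 mul0r.
have := frob_ge0 B; rewrite le_eqVlt => /predU1P[/esym B0|B0].
  by rewrite B0 (frob0_eq0 B0) mulmx0 linear0 mulr0.
have := sqr_ge0 (frob (frob B *: A - frob A *: B)).
have trZ (c : R) (X : 'M[R]_(a, b)) : (c *: X)^T = c *: X^T by rewrite linearZ.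
rewrite frob_sqr [(_ - _)^T]raddfB /= !trZ mulmxBl !mulmxBr.
rewrite -!scalemxAl -!scalemxAr !raddfB /= !mxtraceZ -!frob_sqr.
rewrite [\tr (B^T *m A)](_ : _ = \tr (A^T *m B)); last first.
  by rewrite -mxtrace_tr trmx_mul trmxK.
set x := frob A in A0 *; set y := frob B in B0 *; set t := \tr _.
have xy : 0 < 2 * (x * y) by rewrite !mulr_gt0.
rewrite -[t <= _]subr_ge0 -[0 <= _ - t](pmulr_rge0 _ xy).
by congr (_ <= _); ring.
Qed.

Lemma frob_normCauchySchwarz {a b : nat} (A B : 'M[R]_(a, b)) :
  `|\tr (A^T *m B)| <= frob A * frob B.
Proof.
rewrite ler_norml frob_CauchySchwarz andbT lerNl.
by rewrite -raddfN -mulNmx -raddfN -(frobN A) frob_CauchySchwarz.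
Qed.

(** The entries of [A *m A^T] are inner products of rows of [A]; Cauchy-Schwarz applies to each. *)
Lemma frob_mulmx_tr {a b : nat} (A : 'M[R]_(a, b)) :
  frob (A *m A^T) <= frob A ^+ 2.
Proof.
have sumE : frob A ^+ 2 = \sum_i frob (row i A) ^+ 2.
  rewrite frob_sqr mxtrace_trmul; apply: eq_bigr => i _.
  rewrite frob_sqr mxtrace_trmul big_ord1.
  by apply: eq_bigr => j _; rewrite mxE.
rewrite -(@ler_pXn2r _ 2) ?nnegrE ?frob_ge0 ?sqr_ge0//.
rewrite (frob_sqr (A *m A^T)) mxtrace_trmul.
rewrite sumE [leRHS]expr2 mulr_suml; apply: ler_sum => i _.
rewrite mulr_sumr; apply: ler_sum => j _.
rewrite -expr2 -exprMn -real_normK ?num_real// ler_pXn2r ?nnegrE ?mulr_ge0 ?frob_ge0//.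
suff -> : (A *m A^T) i j = \tr ((row j A)^T^T *m (row i A)^T).
  apply: le_trans (frob_normCauchySchwarz _ _) _.
  by rewrite !frob_tr mulrC.
rewrite trmxK trace_mx11 !mxE; apply: eq_bigr => l _.
by rewrite !mxE mulrC.
Qed.

(** Cauchy-Schwarz against the identity. It turns a bound on a covariance into a bound on its
    factor. *)
Lemma frob_sqr_le_mulmx_tr {a b : nat} (A : 'M[R]_(a, b)) :
  frob A ^+ 2 <= frob (1%:M : 'M[R]_a) * frob (A *m A^T).
Proof.
rewrite frob_sqr mxtrace_mulC.
by have := frob_CauchySchwarz 1%:M (A *m A^T); rewrite trmx1 mul1mx.
Qed.

End frobenius.

(** * Equality cases of the Young inequalities *)

Section worst_case_noise.
Context {R : realType} {r : nat} {gam : R -> R} {lambda : R}.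
Hypothesis gamK : Kinfty_with_Kinfty_derivative gam.
Hypothesis lambda_gt0 : 0 < lambda.
Implicit Types A S : 'M[R]_r.

(** This is the gap [Q1]: Young's inequality at [frob (S *m S^T) / lambda], scaled by [lambda], plus
    Cauchy-Schwarz for the trace. *)
Lemma noise_term_ge0 {A S} :
  0 <= lambda * legendre_fenchel gam (frob A)
       + lambda * gam (frob (S *m S^T) / lambda) + \tr (S^T *m A *m S).
Proof.
have symS : (S *m S^T)^T = S *m S^T by rewrite trmx_mul trmxK.
have -> : \tr (S^T *m A *m S) = \tr ((S *m S^T)^T *m A).
  by rewrite symS mxtrace_mulC mulmxA.
have := frob_normCauchySchwarz (S *m S^T) A.
rewrite ler_norml => /andP[+ _].
have s0 : 0 <= frob (S *m S^T) / lambda by rewrite divr_ge0 ?frob_ge0// ltW.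
have := young_legendre_fenchel gamK s0 (frob_ge0 A).
rewrite -(ler_pM2l lambda_gt0) mulrA [_ * (frob _ / lambda)]mulrC divfK ?gt_eqF//.
by move=> ? ?; lra.
Qed.

(** [S *m S^T] is a nonpositive multiple of [A], so Cauchy-Schwarz is tight, and its norm over
    [lambda] is the equality point of Young's inequality. *)
Lemma noise_term_eq0 {A S} : A^T = A ->
  S *m S^T = (- (lambda * Kinv (hderive gam) (frob A) / frob A)) *: A ->
  lambda * legendre_fenchel gam (frob A)
  + lambda * gam (frob (S *m S^T) / lambda) + \tr (S^T *m A *m S) = 0.
Proof.
move=> symA SE.
have [[g0 _ _ _] _ gam'K] := gamK.
have k0 := Kinv_ge0 gam'K (frob_ge0 A).
have -> : \tr (S^T *m A *m S) = - (lambda * Kinv (hderive gam) (frob A) * frob A).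
  rewrite mxtrace_mulC mulmxA SE -scalemxAl mxtraceZ -{3}symA -frob_sqr.
  have [A0|A0] := eqVneq (frob A) 0; first by rewrite A0; ring.
  by rewrite mulNr expr2 mulrA divfK.
have -> : frob (S *m S^T) / lambda = Kinv (hderive gam) (frob A).
  rewrite SE frobZ normrN ger0_norm ?mulr_ge0 ?invr_ge0 ?frob_ge0 ?(ltW lambda_gt0)//.
  (* At [frob A = 0] both sides vanish, because the inverse sends 0 to 0. *)
  have [A0|A0] := eqVneq (frob A) 0.
    rewrite A0 mulr0 mul0r.
    by have [-> _ _ _] := class_Kinfty_Kinv gam'K.
  by rewrite divfK// mulrAC mulfV ?mul1r// gt_eqF.
rewrite legendre_fenchelE ?frob_ge0//; ring.
Qed.

End worst_case_noise.

Section optimal_control.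
Context {R : realType} {m : nat} {gam : R -> R} {beta : R} {Q : 'M[R]_m}.
Hypothesis gamK : Kinfty_with_Kinfty_derivative gam.
Hypothesis beta_gt0 : 0 < beta.
Hypothesis Q_pos : pos_def Q.
Implicit Types (a : 'rV[R]_m) (v : 'cV[R]_m).

Lemma sqrtmx_spec : nonneg_def (sqrtmx Q) /\ sqrtmx Q *m sqrtmx Q = Q.
Proof.
exact: (@xgetPex _ 0 [set S : 'M[R]_m | nonneg_def S /\ S *m S = Q] (pos_def_sqrt Q_pos)).
Qed.

Lemma pos_def_unitmx : Q \in unitmx.
Proof.
rewrite -row_free_unit -kermx_eq0; apply/rowV0P => v /sub_kermxP vQ.
have [_ pos] := Q_pos; apply/eqP/negPn/negP => v0.
have := pos v^T; rewrite trmx_eq0 v0 trmxK vQ mul0mx mxE ltxx.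
by move=> /(_ isT).
Qed.

Lemma sqrtmx_unitmx : sqrtmx Q \in unitmx.
Proof.
by have [_ SS] := sqrtmx_spec; have := pos_def_unitmx;
  rewrite -{1}SS unitmx_mul => /andP[].
Qed.

Let size a := frob (a *m invmx (sqrtmx Q)).

(** Inserting [sqrtmx Q] and its inverse writes [a *m v] as the inner product of [sqrtmx Q *m v] and
    the transpose of [a *m invmx (sqrtmx Q)]; Cauchy-Schwarz and Young conclude. *)
Lemma control_term_le {a v} :
  2 / beta * (a *m v) 0 0 <=
  legendre_fenchel gam (size a) + gam (2 / beta * frob (sqrtmx Q *m v)).
Proof.
have b0 : 0 <= 2 / beta by rewrite divr_ge0// ltW.
have := young_legendre_fenchel gamK (mulr_ge0 b0 (frob_ge0 (sqrtmx Q *m v)))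
  (frob_ge0 (a *m invmx (sqrtmx Q))).
rewrite [X in _ <= X]addrC; apply: le_trans.
rewrite -[leRHS]mulrA ler_wpM2l//.
have := frob_CauchySchwarz (sqrtmx Q *m v) (a *m invmx (sqrtmx Q))^T.
rewrite frob_tr -trmx_mul mxtrace_tr -mulmxA mulKmx ?sqrtmx_unitmx//.
by rewrite trace_mx11.
Qed.

(** For this [v] the two vectors of that inner product are parallel, and
    [2 / beta * frob (sqrtmx Q *m v)] is the equality point [Kinv (hderive gam) (size a)] of Young's
    inequality. *)
Lemma control_term_eq {a v} :
  v = (beta / 2 * (Kinv (hderive gam) (size a) / size a)) *: (invmx Q *m a^T) ->
  2 / beta * (a *m v) 0 0 =
  legendre_fenchel gam (size a) + gam (2 / beta * frob (sqrtmx Q *m v)).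
Proof.
have [[symS _] SS] := sqrtmx_spec; have Su := sqrtmx_unitmx.
have invQ : invmx Q = invmx (sqrtmx Q) *m invmx (sqrtmx Q).
  apply: (can_inj (mulKmx pos_def_unitmx)).
  by rewrite mulmxV ?pos_def_unitmx// -{1}SS mulmxA mulmxK// mulmxV.
have [_ _ gam'K] := gamK.
have c0 : 0 <= size a by exact: frob_ge0.
have k0 := Kinv_ge0 gam'K c0.
have trS : (invmx (sqrtmx Q))^T = invmx (sqrtmx Q) by rewrite trmx_inv symS.
have aQa : (a *m (invmx Q *m a^T)) 0 0 = size a ^+ 2.
  rewrite /size -frob_tr frob_sqr trmxK trmx_mul trS invQ trace_mx11.
  by rewrite !mulmxA.
have frobSv : frob (sqrtmx Q *m (invmx Q *m a^T)) = size a.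
  by rewrite invQ -mulmxA mulKVmx// -{1}trS -trmx_mul frob_tr.
move=> ->; rewrite -!scalemxAr mxE aQa frobZ frobSv.
rewrite ger0_norm ?mulr_ge0 ?invr_ge0 ?(ltW beta_gt0)//.
rewrite legendre_fenchelE//.
have [s0|s0] := eqVneq (size a) 0.
  have [k00 _ _ _] := class_Kinfty_Kinv gam'K.
  rewrite s0 k00 expr0n /= !(mulr0, mul0r).
  by ring.
have -> : 2 / beta * (beta / 2 * (Kinv (hderive gam) (size a) / size a) * size a)
   = Kinv (hderive gam) (size a).
  by field; rewrite s0 gt_eqF.
by field; rewrite s0 gt_eqF.
Qed.

End optimal_control.

(** * Integration *)

Lemma maxr0_sub {R : realDomainType} (x : R) : Num.max x 0 = x + Num.max (- x) 0.
Proof. by rewrite addr_maxr subrr addr0 maxC. Qed.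

Lemma maxr0D_le {R : realDomainType} (x y : R) :
  Num.max (x + y) 0 <= Num.max x 0 + Num.max y 0.
Proof. by rewrite ge_max lerD ?addr_ge0// le_max lexx ?orbT. Qed.

Section quasi_integrable.
Local Open Scope ereal_scope.
Context {d : measure_display} {T : measurableType d} {R : realType}.
Variables (mu : {measure set T -> \bar R}) (D : set T).
Hypothesis mD : measurable D.

(** Positive parts increase and negative parts decrease; extended subtraction, with
    [+oo - +oo = -oo], respects both, so infinite integrals are covered. *)
Lemma ae_le_integral {f g : T -> \bar R} :
  measurable_fun D f -> measurable_fun D g ->
  {ae mu, forall x, D x -> f x <= g x} ->
  \int[mu]_(x in D) f x <= \int[mu]_(x in D) g x.
Proof.
move=> mf mg fg; rewrite integralE [leRHS]integralE leeB//.
- apply: ae_ge0_le_integral => //; try exact: measurable_funepos.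
  apply: filterS fg => x fg Dx; rewrite !funeposE ge_max !le_max lexx orbT andbT.
  by rewrite fg.
- apply: ae_ge0_le_integral => //; try exact: measurable_funeneg.
  apply: filterS fg => x fg Dx; rewrite !funenegE ge_max !le_max lexx orbT andbT.
  by rewrite leeN2 fg.
Qed.

(** Cancellation for the integrals of positive and negative parts of a sum ([a], [b]), of [f] ([c],
    [e]) and of [g] ([p], [q]). The two bounds make [a] finite when [c] is, and [b] finite when [e]
    is. *)
Lemma sube_addfin {a b c e : \bar R} {p q : R} :
  0 <= a -> 0 <= b -> 0 <= c -> 0 <= e -> c < +oo \/ e < +oo ->
  a <= c + p%:E -> b <= e + q%:E -> a + e + q%:E = b + c + p%:E ->
  a - b = c - e + (p%:E - q%:E).
Proof.
move: c e => [c| |] [e| |] // + + _ _ ce; move: a => [a| |] // _; move: b => [b| |] // _;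
  rewrite ?ltxx in ce; try by case: ce.
by move=> _ _ [E]; rewrite -!EFinN -!EFinD; congr EFin; lra.
Qed.

(** The decomposition into positive and negative parts is rearranged so that only nonnegative
    functions are added. An infinite integral of [f] is allowed, as the expected initial cost may be
    infinite. *)
Lemma integralD_quasi {f g : T -> R} :
  has_integral mu D (EFin \o f) -> mu.-integrable D (EFin \o g) ->
  \int[mu]_(x in D) (f x + g x)%:E =
  \int[mu]_(x in D) (f x)%:E + \int[mu]_(x in D) (g x)%:E.
Proof.
move=> [mf fint] ig; have mg := measurable_int mu ig.
pose s x := (f x + g x)%:E.
have ms : measurable_fun D s by exact: emeasurable_funD mf mg.
have [mfp mfn] := (measurable_funepos mf, measurable_funeneg mf).
have [mgp mgn] := (measurable_funepos mg, measurable_funeneg mg).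
have [msp msn] := (measurable_funepos ms, measurable_funeneg ms).
have E : \int[mu]_(x in D) s^\+ x + \int[mu]_(x in D) (EFin \o f)^\- x
         + \int[mu]_(x in D) (EFin \o g)^\- x
       = \int[mu]_(x in D) s^\- x + \int[mu]_(x in D) (EFin \o f)^\+ x
         + \int[mu]_(x in D) (EFin \o g)^\+ x.
  rewrite -!ge0_integralD//; try exact: emeasurable_funD.
    apply: eq_integral => x _; rewrite !funeposE !funenegE /s /=.
    rewrite -?EFinN -!EFin_max -!EFinD; congr EFin.
    have := maxr0_sub (f x + g x); have := maxr0_sub (f x).
    have := maxr0_sub (g x); lra.
  - by move=> x _; rewrite adde_ge0.
  - by move=> x _; rewrite adde_ge0.
have le_p : \int[mu]_(x in D) s^\+ x <=
    \int[mu]_(x in D) (EFin \o f)^\+ x + \int[mu]_(x in D) (EFin \o g)^\+ x.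
  rewrite -ge0_integralD//; apply: ge0_le_integral => //.
  - exact: emeasurable_funD.
  - move=> x _; rewrite !funeposE /s /=.
    by rewrite -!EFin_max -!EFinD lee_fin maxr0D_le.
have le_n : \int[mu]_(x in D) s^\- x <=
    \int[mu]_(x in D) (EFin \o f)^\- x + \int[mu]_(x in D) (EFin \o g)^\- x.
  rewrite -ge0_integralD//; apply: ge0_le_integral => //.
  - exact: emeasurable_funD.
  - move=> x _; rewrite !funenegE /s /=.
    by rewrite -?EFinN -!EFin_max -!EFinD lee_fin opprD maxr0D_le.
have gp := integrable_pos_fin_num mD ig.
have gn := integrable_neg_fin_num mD ig.
rewrite (integralE mu D s) (integralE mu D (EFin \o f)) (integralE mu D (EFin \o g)).
rewrite -(fineK gp) -(fineK gn) in E le_p le_n *.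
apply: sube_addfin le_p le_n E => //; exact: integral_ge0.
Qed.

End quasi_integrable.

(** * Comparison of expected costs with the initial cost by Dynkin's formula *)

Section dynkin.
Local Open Scope ereal_scope.
Context {R : realType} {n : nat} {d : measure_display} {Omega : measurableType d}.
Context {P : probability Omega R} {h : 'cV[R]_n -> R} {Lh : R -> 'cV[R]_n -> R}
  {X : R -> Omega -> 'cV[R]_n} {c : R}.
Hypothesis dynkin : dynkin_formula P h Lh X.
Hypothesis initial_quasi : has_integral P setT (fun om => (c * h (X 0%R om))%:E).

(** Subtracting [c * Y], of zero mean by Dynkin's formula, from the initial cost trades [h (X 0)]
    for [h (X t)] and the integral of the generator, without splitting an expectation that may be
    infinite. *)
Let dynkin_cost {t : R} : (0 <= t)%R -> exists G : Omega -> R,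
  [/\ measurable_fun setT (EFin \o G),
      \int[P]_om (G om)%:E = \int[P]_om (c * h (X 0%R om))%:E &
      {ae P, forall om,
         lebesgue_measure.-integrable `[0%R, t] (fun s => (- c * Lh s (X s om))%:E) /\
         (G om)%:E = (c * h (X t om))%:E
           + \int[lebesgue_measure]_(s in `[0%R, t]) (- c * Lh s (X s om))%:E}].
Proof.
move=> t0; have [iLh iY EY] := dynkin t t0.
pose Y om := (h (X 0 om) - h (X t om)
      + \int[lebesgue_measure]_(s in `[0, t]) Lh s (X s om))%R.
have icY : P.-integrable setT (EFin \o (fun om => - c * Y om)%R).
  exact: (integrableZl measurableT (- c) iY).
exists (fun om => c * h (X 0 om) + - c * Y om)%R; split.
- have [mh _] := initial_quasi.
  exact: (emeasurable_funD mh (measurable_int P icY)).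
- rewrite integralD_quasi// [X in _ + X](_ : _ = 0) ?adde0//.
  by have := integralZl measurableT iY (- c)%R; rewrite EY mule0.
- apply: filterS iLh => om iLh.
  have icLh : lebesgue_measure.-integrable `[0%R, t] (fun s => (- c * Lh s (X s om))%:E).
    exact: (integrableZl _ (- c) iLh).
  split=> //.
  rewrite [X in _ + X](_ : _ = (- c)%:E * \int[lebesgue_measure]_(s in `[0%R, t]) (Lh s (X s om))%:E); last exact: (integralZl _ iLh (- c)).
  rewrite -[X in _ * X]fineK ?integrable_fin_num//.
  by rewrite -EFinM -EFinD; congr EFin; rewrite /Y /Rintegral; ring.
Qed.

Context {rc : R -> Omega -> R} {t : R}.
Let cost om := (c * h (X t om))%:E + \int[lebesgue_measure]_(s in `[0%R, t]) (rc s om)%:E.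
Hypothesis t_ge0 : (0 <= t)%R.
Hypothesis rc_quasi : {ae P, forall om,
  has_integral lebesgue_measure `[0%R, t] (fun s => (rc s om)%:E)}.
Hypothesis cost_quasi : has_integral P setT cost.

(** Almost surely the cost is at most the variable [G] of [dynkin_cost]. *)
Lemma expected_cost_le_initial :
  (forall s om, (rc s om <= - c * Lh s (X s om))%R) ->
  \int[P]_om cost om <= \int[P]_om (c * h (X 0%R om))%:E.
Proof.
move=> rcL; have [G [mG <- GE]] := dynkin_cost t_ge0.
apply: ae_le_integral => //; first by case: cost_quasi.
apply: filterS2 rc_quasi GE => om [mrc _] [iL ->] _.
rewrite leeD2l//; apply: ae_le_integral => //; first exact: measurable_int iL.
by apply: aeW => s _; rewrite lee_fin.
Qed.

Lemma expected_cost_ge_initial :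
  (forall s om, (- c * Lh s (X s om) <= rc s om)%R) ->
  \int[P]_om (c * h (X 0%R om))%:E <= \int[P]_om cost om.
Proof.
move=> rcL; have [G [mG <- GE]] := dynkin_cost t_ge0.
apply: ae_le_integral => //; first by case: cost_quasi.
apply: filterS2 rc_quasi GE => om [mrc _] [iL ->] _.
rewrite leeD2l//; apply: ae_le_integral => //; first exact: measurable_int iL.
by apply: aeW => s _; rewrite lee_fin.
Qed.

End dynkin.

(** * Inverse optimality *)

Section pointwise.
Context {R : realType} {n m r : nat}.
Context {f : 'cV[R]_n -> 'cV[R]_n} {g1 : 'cV[R]_n -> 'M[R]_(n, r)}
  {g2 : 'cV[R]_n -> 'M[R]_(n, m)} {h : 'cV[R]_n -> R}
  {R2 : 'cV[R]_n -> 'cV[R]_m -> 'M[R]_m} {gam1 gam2 : R -> R}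
  {u0 : R -> 'cV[R]_n -> 'cV[R]_m} {beta lambda : R}.

(** The brackets are [Q1] and [Q2]. Their trace and [lieg h g2 x *m v t x] terms cancel those of the
    generator; the rest is algebra. *)
Lemma running_costE v S t x : beta != 0 ->
  running_cost f g1 g2 h R2 gam1 gam2 u0 beta lambda v S t x =
  - (2 * beta) * generator h g1 (closed_loop f g2 u0 v) S t x
  + beta * (lambda * legendre_fenchel gam1 (noise_size g1 h x)
            + lambda * gam1 (frob (S t x *m (S t x)^T) / lambda)
            + \tr ((S t x)^T *m noise_hess h g1 x *m S t x))
  - beta ^+ 2 * (legendre_fenchel gam2 (control_size g2 h R2 x (u0 t x))
       + gam2 (2 / beta * frob (sqrtmx (R2 x (u0 t x)) *m v t x))
       - 2 / beta * (lieg h g2 x *m v t x) 0 0).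
Proof.
move=> b0; rewrite /running_cost /state_cost /barrier_margin /generator /closed_loop.
have -> : lie h x (f x + g2 x *m (u0 t x + v t x)) =
    lie h x (f x + g2 x *m u0 t x) + (lieg h g2 x *m v t x) 0 0.
  rewrite mulmxDr addrA.
  by rewrite /lie /lieg -[grad h x *m g2 x *m _]mulmxA mulmxDr mxE.
rewrite /noise_hess !mulmxA.
move: (lie _ _ _) (_ 0 0) (\tr _) (legendre_fenchel gam1 _) (legendre_fenchel gam2 _)
  (gam1 _) (gam2 _) => a b tr l1 l2 y1 y2.
by field.
Qed.

Hypothesis gam1_K : Kinfty_with_Kinfty_derivative gam1.
Hypothesis gam2_K : Kinfty_with_Kinfty_derivative gam2.
Hypothesis R2_pos : forall x u, pos_def (R2 x u).
Hypothesis beta_ge2 : 2 <= beta.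
Hypothesis lambda_gt0 : 0 < lambda.
Hypothesis lambda_le2 : lambda <= 2.

Let beta_gt0 : 0 < beta. Proof. exact: lt_le_trans beta_ge2. Qed.

Lemma running_cost_worst_noise v S t x : (noise_hess h g1 x)^T = noise_hess h g1 x ->
  S t x *m (S t x)^T = (- (lambda * Kinv (hderive gam1) (noise_size g1 h x)
     / noise_size g1 h x)) *: noise_hess h g1 x ->
  running_cost f g1 g2 h R2 gam1 gam2 u0 beta lambda v S t x <=
  - (2 * beta) * generator h g1 (closed_loop f g2 u0 v) S t x.
Proof.
move=> symA SE; rewrite running_costE ?gt_eqF//.
have -> := noise_term_eq0 gam1_K lambda_gt0 symA SE.
rewrite mulr0 addr0 gerBl mulr_ge0 ?sqr_ge0// subr_ge0.
exact: control_term_le.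
Qed.

Lemma running_cost_ubar_star S t x :
  - (2 * beta) * generator h g1
     (closed_loop f g2 u0 (fun t x => ubar_star g2 h R2 gam2 beta x (u0 t x))) S t x <=
  running_cost f g1 g2 h R2 gam1 gam2 u0 beta lambda
    (fun t x => ubar_star g2 h R2 gam2 beta x (u0 t x)) S t x.
Proof.
rewrite running_costE ?gt_eqF//.
rewrite (control_term_eq gam2_K beta_gt0 (R2_pos x (u0 t x)) erefl).
rewrite subrr mulr0 subr0 lerDl mulr_ge0 ?(ltW beta_gt0)//.
exact: noise_term_ge0.
Qed.

(** Since [2 <= beta] and [lambda <= 2], the last two terms of the state cost are nonpositive. *)
Lemma state_cost_le (alpha : R -> R) x u :
  - alpha (h x) <= barrier_margin f g1 g2 h R2 gam1 gam2 x u ->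
  state_cost f g1 g2 h R2 gam1 gam2 beta lambda x u <= 2 * beta * alpha (h x).
Proof.
move=> ma; rewrite /state_cost.
have P2 : 0 <= beta * (beta - 2) * legendre_fenchel gam2 (control_size g2 h R2 x u).
  by rewrite !mulr_ge0 ?subr_ge0 ?(ltW beta_gt0)// legendre_fenchel_ge0 ?frob_ge0.
have P1 : 0 <= beta * (2 - lambda) * legendre_fenchel gam1 (noise_size g1 h x).
  by rewrite !mulr_ge0 ?subr_ge0 ?(ltW beta_gt0)// legendre_fenchel_ge0 ?frob_ge0.
move: ma P2 P1; move: (barrier_margin _ _ _ _ _ _ _ _ _) (legendre_fenchel gam1 _)
  (legendre_fenchel gam2 _) (alpha _) => b l1 l2 a ab P2 P1.
have : 0 <= 2 * beta * (b + a).
  by rewrite mulr_ge0 ?(ltW beta_gt0)// ?mulr_ge0 ?(ltW beta_gt0)// -lerBlDr sub0r.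
lra.
Qed.

(** * The worst-case covariance *)

Context {Sigma_bar : 'cV[R]_n -> 'M[R]_r}.
Hypothesis Sigma_bar_cov : @covariances R n r (fun _ => Sigma_bar).
Hypothesis Sigma_barE : forall x,
  Sigma_bar x *m (Sigma_bar x)^T = aux_covariance g1 h gam1 x.

(** Symmetry is inherited from [Sigma_bar x *m (Sigma_bar x)^T], a nonzero multiple of the noise
    Hessian wherever the latter is nonzero. *)
Lemma noise_hess_sym x : (noise_hess h g1 x)^T = noise_hess h g1 x.
Proof.
have := frob_ge0 (noise_hess h g1 x); rewrite le_eqVlt => /predU1P[/esym A0|N0].
  by rewrite (frob0_eq0 A0) trmx0.
pose c := - 2 * (legendre_fenchel gam1 (noise_size g1 h x) / noise_size g1 h x ^+ 2).
have c0 : c != 0.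
  rewrite /c mulf_neq0 ?oppr_eq0 ?pnatr_eq0// mulf_neq0//.
    by rewrite gt_eqF// legendre_fenchel_gt0.
  by rewrite invr_eq0 expf_neq0// gt_eqF.
have AE : noise_hess h g1 x = c^-1 *: (Sigma_bar x *m (Sigma_bar x)^T).
  by rewrite Sigma_barE scalerA mulVf// scale1r.
by rewrite AE linearZ /= trmx_mul trmxK.
Qed.

Let k := Kinv (hderive gam1).

(* Sigma_bar is rescaled so that Young's inequality for the noise becomes an
   equality. *)
Definition worst_noise x : 'M[R]_r :=
  Num.sqrt (lambda * k (noise_size g1 h x) * noise_size g1 h x
            / (2 * legendre_fenchel gam1 (noise_size g1 h x))) *: Sigma_bar x.

Let gam1'_K : class_Kinfty (hderive gam1). Proof. by case: gam1_K. Qed.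
Let k_K : class_Kinfty k. Proof. exact: class_Kinfty_Kinv. Qed.

Lemma worst_noiseE x : worst_noise x *m (worst_noise x)^T =
  (- (lambda * k (noise_size g1 h x) / noise_size g1 h x)) *: noise_hess h g1 x.
Proof.
have N0 : 0 <= noise_size g1 h x by exact: frob_ge0.
rewrite /worst_noise linearZ /= -scalemxAl -scalemxAr scalerA -expr2 sqr_sqrtr; last first.
  rewrite !mulr_ge0 ?(ltW lambda_gt0) ?Kinv_ge0// invr_ge0 mulr_ge0//.
  by rewrite legendre_fenchel_ge0.
rewrite Sigma_barE /aux_covariance scalerA.
move: N0; rewrite le_eqVlt => /predU1P[/esym A0|N0].
  by rewrite (frob0_eq0 A0) !scaler0.
congr (_ *: _); field.
by rewrite gt_eqF// gt_eqF// legendre_fenchel_gt0.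
Qed.

(** The auxiliary covariance has norm [2 * legendre_fenchel gam1 N / N], which is at least
    [k (N / 2)]; inverting [k] bounds [N]. Local boundedness of the noise Hessian thus comes from
    that of [Sigma_bar]. *)
Lemma noise_size_le x M : frob (Sigma_bar x) <= M ->
  noise_size g1 h x <= 2 * hderive gam1 (M ^+ 2).
Proof.
move=> SM; have N0 : 0 <= noise_size g1 h x by exact: frob_ge0.
have M0 : 0 <= M := le_trans (frob_ge0 _) SM.
have M20 : 0 <= M ^+ 2 by rewrite sqr_ge0.
have g0 : 0 <= hderive gam1 (M ^+ 2) by rewrite Kinfty_ge0.
move: N0; rewrite le_eqVlt => /predU1P[<-|N0]; first by rewrite mulr_ge0.
have SS : frob (Sigma_bar x *m (Sigma_bar x)^T) <= M ^+ 2.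
  apply: le_trans (frob_mulmx_tr _) _.
  by rewrite ler_pXn2r ?nnegrE ?frob_ge0.
have kM : k (noise_size g1 h x / 2) <= M ^+ 2.
  apply: le_trans SS; rewrite Sigma_barE /aux_covariance frobZ.
  have l0 := legendre_fenchel_ge_half gam1_K (ltW N0).
  rewrite normrM normrN (ger0_norm (ler0n _ 2)) ger0_norm; last first.
    by rewrite divr_ge0 ?sqr_ge0// legendre_fenchel_ge0// ltW.
  rewrite -/(noise_size g1 h x) expr2 invfM !mulrA divfK ?gt_eqF//.
  rewrite ler_pdivlMr// mulrC -/k.
  move: l0; rewrite -/k; lra.
rewrite -ler_pdivrMl// mulrC.
rewrite -(Kinfty_leE k_K) ?divr_ge0 ?(ltW N0)//.
by move: kM; rewrite /k (KinftyK gam1'_K).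
Qed.

Lemma worst_noise_covariances : @covariances R n r (fun _ => worst_noise).
Proof.
have [lb nn] := Sigma_bar_cov; split; last first.
  move=> t x; have [symS posS] := nn t x; split.
    by rewrite /worst_noise linearZ /= symS.
  move=> v; rewrite /worst_noise -scalemxAr -scalemxAl mxE.
  by rewrite mulr_ge0 ?sqrtr_ge0.
(* [Sigma_bar] does not depend on time, so its bound at time 0 serves for all times. *)
move=> T rho; have [M hM] := lb 0 rho.
(* The second factor of [B] bounds the norm [lambda * k N] of the covariance; the first comes from
   [frob_sqr_le_mulmx_tr]. *)
pose B := frob (1%:M : 'M[R]_r) * (lambda * k (2 * hderive gam1 (M ^+ 2))).
exists (Num.sqrt B) => t x _ xrho.
have {hM} SM : frob (Sigma_bar x) <= M by apply: (hM 0 x) => //; rewrite lexx.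
have NM := noise_size_le _ _ SM.
have N0 : 0 <= noise_size g1 h x by exact: frob_ge0.
have k0 : 0 <= k (noise_size g1 h x) by exact: Kinv_ge0.
rewrite -[leLHS]ger0_norm ?frob_ge0// -sqrtr_sqr; apply: ler_wsqrtr.
apply: le_trans (frob_sqr_le_mulmx_tr _) _.
apply: ler_wpM2l; first exact: frob_ge0.
rewrite worst_noiseE frobZ normrN ger0_norm ?mulr_ge0 ?invr_ge0 ?(ltW lambda_gt0)//.
rewrite -/(noise_size g1 h x).
apply: (@le_trans _ _ (lambda * k (noise_size g1 h x))).
  have [->|Nn0] := eqVneq (noise_size g1 h x) 0; last by rewrite divfK.
  by rewrite mulr0 mulr_ge0 ?(ltW lambda_gt0)// Kinv_ge0.
rewrite ler_pM2l// (Kinfty_leE k_K)//.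
exact: le_trans NM.
Qed.

(** Together with [worst_noise_covariances], this places the worst-case noise in the class [C] of
    the theorem. *)
Lemma worst_noise_auxiliary_form : of_auxiliary_form g1 h worst_noise.
Proof.
exists (fun y => lambda * k y); last by move=> x; exact: worst_noiseE.
have [k0 kc kmono kub] := k_K; split.
- by rewrite k0 mulr0.
- by move=> y; apply: cvgM; [exact: cvg_cst|exact: kc].
- by move=> s t s0 st; rewrite ltr_pM2l// kmono.
- move=> M; have [s s0 Ms] := kub (M / lambda); exists s => //.
  by rewrite mulrC -ler_pdivrMr.
Qed.

End pointwise.

Theorem theorem11 (R : realType) (n m r : nat)
  (f : 'cV[R]_n -> 'cV[R]_n) (g1 : 'cV[R]_n -> 'M[R]_(n, r))
  (g2 : 'cV[R]_n -> 'M[R]_(n, m)) (h : 'cV[R]_n -> R)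
  (R2 : 'cV[R]_n -> 'cV[R]_m -> 'M[R]_m) (gam1 gam2 : R -> R)
  (u0 : R -> 'cV[R]_n -> 'cV[R]_m)
  (Sigma_bar : 'cV[R]_n -> 'M[R]_r) (alpha : R -> R) (beta lambda : R)
  (d : measure_display) (Omega : measurableType d) (P : probability Omega R)
  (F : R -> set (set Omega)) (W : R -> Omega -> 'cV[R]_r)
  (xi : Omega -> 'cV[R]_n) (C : set (R -> 'cV[R]_n -> 'M[R]_r))
  (f_lip : locally_lipschitz f) (g1_lip : locally_lipschitz g1)
  (g2_lip : locally_lipschitz g2)
  (h_cand : NSSf_CBF_candidate h)
  (gam1_K : Kinfty_with_Kinfty_derivative gam1)
  (gam2_K : Kinfty_with_Kinfty_derivative gam2)
  (R2_pos : forall x u, pos_def (R2 x u))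
  (Sigma_bar_cov : @covariances R n r (fun _ => Sigma_bar))
  (Sigma_barE : forall x,
     Sigma_bar x *m (Sigma_bar x)^T = aux_covariance g1 h gam1 x)
  (sbf : SBFc h g1
     (closed_loop f g2 u0 (fun t x => ubar g2 h R2 gam2 x (u0 t x)))
     (fun _ => Sigma_bar))
  (alpha_K : class_K_h h alpha)
  (sbf_alpha : forall t x, 0 <= t ->
     lie h x (f x + g2 x *m u0 t x)
     - legendre_fenchel gam1 (noise_size g1 h x)
     + legendre_fenchel gam2 (control_size g2 h R2 x (u0 t x))
     >= - alpha (h x))
  (beta_ge2 : 2 <= beta) (lambda_gt0 : 0 < lambda) (lambda_le2 : lambda <= 2)
  (F_filt : filtration F) (W_wiener : wiener P F W)
  (xi_meas : forall i, measurable_wrt (F 0) (fun om => xi om i ord0))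
  (C_cov : C `<=` @covariances R n r)
  (C_aux : forall S : 'cV[R]_n -> 'M[R]_r, covariances (fun _ => S) ->
     of_auxiliary_form g1 h S -> C (fun _ => S))
  (star_adm : admissible f g1 g2 h R2 gam1 gam2 u0 beta lambda P F W xi C
     (fun t x => ubar_star g2 h R2 gam2 beta x (u0 t x))) :
  (forall v : R -> 'cV[R]_n -> 'cV[R]_m,
     admissible f g1 g2 h R2 gam1 gam2 u0 beta lambda P F W xi C v ->
     (J f g1 g2 h R2 gam1 gam2 u0 beta lambda P F W xi C v <=
      J f g1 g2 h R2 gam1 gam2 u0 beta lambda P F W xi C
        (fun t x => ubar_star g2 h R2 gam2 beta x (u0 t x)))%E) /\
  (forall t x, 0 <= t ->
     state_cost f g1 g2 h R2 gam1 gam2 beta lambda x (u0 t x) <=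
     2 * beta * alpha (h x)).
Proof.
split=> [v v_adm|t x t0]; last first.
  by apply: state_cost_le => //; exact: sbf_alpha.
pose S0 : R -> 'cV[R]_n -> 'M[R]_r :=
  fun _ => @worst_noise _ _ _ g1 h gam1 lambda Sigma_bar.
have CS0 : C S0.
  by apply: C_aux; [exact: worst_noise_covariances|exact: worst_noise_auxiliary_form].
(* At time 0 the running integral is over a single point, so the path cost is the initial cost. *)
have initial_quasi w S X : (forall t, 0 <= t -> has_integral P setT
      (path_cost f g1 g2 h R2 gam1 gam2 u0 beta lambda w S X t)) ->
    has_integral P setT (fun om => (2 * beta * h (X 0 om))%:E).
  move=> /(_ 0 (lexx 0)); congr has_integral.
  apply/funext => om; rewrite /path_cost /path_running_cost.
  by rewrite set_itv1 integral_set1 adde0.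
have [[X0 X0_sol] X0_adm] := v_adm _ CS0.
have [X0_quasi X0_cvg X0_dynkin] := X0_adm _ X0_sol.
have X0_iq := initial_quasi _ _ _ (fun t t0 => (X0_quasi t t0).2).
(* The expected initial cost separates the two values of [J]: the first is bounded using the single
   pair [S0], [X0], the second over all pairs. *)
apply: (@le_trans _ _ (\int[P]_om (2 * beta * h (X0 0 om))%:E)%E).
  apply: ge_ereal_inf; exists (lim (expected_cost f g1 g2 h R2 gam1 gam2 u0 beta
    lambda P v S0 X0 t @[t --> +oo])); first by exists S0, X0.
  apply: lime_le => //; near=> t.
  have t0 : 0 <= t by near: t; exact: nbhs_pinfty_ge.
  have [rq cq] := X0_quasi t t0.
  apply: (expected_cost_le_initial X0_dynkin X0_iq t0 rq cq) => s om.
  apply: running_cost_worst_noise => //; first exact: (noise_hess_sym gam1_K Sigma_barE).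
  exact: worst_noiseE.
apply: le_ereal_inf_tmp => c [S [X [CS X_sol Xc]]].
have [_ X_adm] := star_adm _ CS.
have [X_quasi _ X_dynkin] := X_adm _ X_sol.
have X_iq := initial_quasi _ _ _ (fun t t0 => (X_quasi t t0).2).
(* Every solution starts almost surely at [xi], so the separating value is the same for [X0] and
   [X]. *)
have -> : (\int[P]_om (2 * beta * h (X0 0 om))%:E
           = \int[P]_om (2 * beta * h (X 0 om))%:E)%E.
  apply: ae_eq_integral => //; [by case: X0_iq|by case: X_iq|].
  have [_ _ X0xi _ _] := X0_sol; have [_ _ Xxi _ _] := X_sol.
  by apply: filterS2 X0xi Xxi => om -> -> _.
apply: cvge_ge Xc; near=> t.
have t0 : 0 <= t by near: t; exact: nbhs_pinfty_ge.
have [rq cq] := X_quasi t t0.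
apply: (expected_cost_ge_initial X_dynkin X_iq t0 rq cq) => s om.
exact: running_cost_ubar_star.
Unshelve. all: by end_near. Qed.
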